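(* Let $U\subset\mathbb R^N$ be open, fix a structure (for each of $M$ equations, the set of variables allowed to appear in it), let $\mathcal F$ be any vector space of $C^\infty$ functions $F:U\to\mathbb R^M$ respecting the structure and containing all linear functions that respect the structure, and let $r$ be the maximum possible rank of the Jacobian, which depends only on the structure. If $r<M$, then $p$ is fragile for every $F\in\mathcal F$ and every $p\in U$. In particular, $\text{SolSet}(p)$ is fragile for every $F\in\mathcal F$ and every $p\in U$.
   Context: Structure. A structure specifies, for each $i\in\{1,\dots,M\}$, a subset of $\{x_1,\dots,x_N\}$ of variables allowed to appear in the $i$-th equation (possibly all variables). A $C^1$ function $F=(f_1,\dots,f_M):U\to\mathbb R^M$ respects the structure if $\partial f_i/\partial x_j\equiv 0$ on $U$ whenever $x_j$ is not allowed in equation $i$. A linear function $x\mapsto Ax$ respects the structure if $A_{ij}=0$ whenever $x_j$ is not allowed in equation $i$. The number $r$ is the maximum rank of all $M\times N$ real matrices $A$ with $A_{ij}=0$ whenever $x_j$ is not allowed in equation $i$; equivalently, the maximum possible rank of $DF(x)$ for $F\in\mathcal F$, $x\in U$. Robustness. A point $x\in U$ is robust for $F$ if $DF(x)$ has rank $M$, and fragile for $F$ if it is not robust. For $p\in U$, $\text{SolSet}(p)=\{x\in U: F(x)=F(p)\}$; it is robust if every $x\in\text{SolSet}(p)$ is robust for $F$, and fragile if it is not robust. *)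

(* Defs.v *)
From HB Require Import structures.
From mathcomp Require Import all_boot all_order all_algebra.
From mathcomp Require Import mathcomp_extra boolp classical_sets functions reals.
From mathcomp Require Import topology normedtype derive.

Set Implicit Arguments.
Unset Strict Implicit.
Unset Printing Implicit Defensive.
Import Order.TTheory GRing.Theory Num.Theory.
Import numFieldNormedType.Exports.
Local Open Scope classical_set_scope.
Local Open Scope ring_scope.

(* Points of R^N and R^M are row vectors. A function U -> R^M is represented
   by a total function on R^N of which only the values on U are relevant. *)

(* [S i] is the set of (indices of) variables allowed in equation [i]. *)
Definition structure (M N : nat) := 'I_M -> {set 'I_N}.

Definition partial (R : realType) (N : nat) (W : normedModType R)
    (j : 'I_N) (f : 'rV[R]_N -> W) : 'rV[R]_N -> W :=
  fun x => 'D_(delta_mx 0 j) f x.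

(* [U] is meant to be open, so that continuity and differentiability at the
   points of [U] do not depend on the values outside [U]. *)
Fixpoint C_k (R : realType) (N : nat) (W : normedModType R)
    (U : set 'rV[R]_N) (k : nat) (f : 'rV[R]_N -> W) : Prop :=
  if k is k'.+1 then
    (forall x, U x -> differentiable f x) /\
    (forall j : 'I_N, C_k U k' (partial j f))
  else forall x, U x -> {for x, continuous f}.

Definition C_infty (R : realType) (N : nat) (W : normedModType R)
    (U : set 'rV[R]_N) (f : 'rV[R]_N -> W) : Prop :=
  forall k, C_k U k f.

(* The library's ['J F x] acts on row vectors on the right, so the usual
   M x N Jacobian matrix is its transpose. *)
Definition DF (R : realType) (M N : nat) (F : 'rV[R]_N -> 'rV[R]_M)
    (x : 'rV[R]_N) : 'M[R]_(M, N) := ('J F x)^T.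

Definition respects (R : realType) (M N : nat) (S : structure M N)
    (U : set 'rV[R]_N) (F : 'rV[R]_N -> 'rV[R]_M) : Prop :=
  forall (i : 'I_M) (j : 'I_N), j \notin S i ->
    forall x, U x -> partial j (fun y => F y 0 i : R) x = 0.

Definition mx_respects (R : realType) (M N : nat) (S : structure M N)
    (A : 'M[R]_(M, N)) : Prop :=
  forall (i : 'I_M) (j : 'I_N), j \notin S i -> A i j = 0.

(* The map x |-> A x, on row vectors. *)
Definition linear_map (R : realType) (M N : nat) (A : 'M[R]_(M, N)) :
    'rV[R]_N -> 'rV[R]_M := fun x => x *m A^T.

(* Maximum of \rank A over the matrices respecting [S]; the bound on the index
   loses nothing since \rank A <= M. *)
Definition max_rank (R : realType) (M N : nat) (S : structure M N) : nat :=
  \max_(k < M.+1 | `[< exists A : 'M[R]_(M, N),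
                         mx_respects S A /\ \rank A = k >]) k.

Lemma max_rank_ge (R : realType) (M N : nat) (S : structure M N)
    (A : 'M[R]_(M, N)) :
  mx_respects S A -> (\rank A <= max_rank R S)%N.
Proof.
move=> SA; have rM : (\rank A < M.+1)%N by rewrite ltnS rank_leq_row.
rewrite -[X in (X <= _)%N]/(Ordinal rM : nat) /max_rank.
by apply: (@leq_bigmax_cond _ _ (fun k : 'I_M.+1 => (k : nat)));
  apply/asboolP; exists A.
Qed.

Lemma max_rank_attained (R : realType) (M N : nat) (S : structure M N) :
  exists A : 'M[R]_(M, N), mx_respects S A /\ \rank A = max_rank R S.
Proof.
rewrite /max_rank; elim/big_ind: _ => [|a b Ha Hb|k /asboolP//].
  by exists 0; split; [move=> i j _; rewrite mxE|rewrite mxrank0].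
by rewrite /maxn; case: ifP.
Qed.

(* A vector space of functions U -> R^M: closure under equality on [U] makes
   sets of total functions correspond exactly to sets of functions on [U]. *)
Definition function_space (R : realType) (M N : nat) (U : set 'rV[R]_N)
    (FF : set ('rV[R]_N -> 'rV[R]_M)) : Prop :=
  GRing.submod_closed [in FF] /\
  (forall F G, FF F -> (forall x, U x -> F x = G x) -> FF G).

Definition robust (R : realType) (M N : nat) (F : 'rV[R]_N -> 'rV[R]_M)
    (x : 'rV[R]_N) : Prop := \rank (DF F x) = M.

Definition fragile (R : realType) (M N : nat) (F : 'rV[R]_N -> 'rV[R]_M)
    (x : 'rV[R]_N) : Prop := ~ robust F x.

Definition SolSet (R : realType) (M N : nat) (U : set 'rV[R]_N)
    (F : 'rV[R]_N -> 'rV[R]_M) (p : 'rV[R]_N) : set 'rV[R]_N :=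
  [set x | U x /\ F x = F p].

Definition robust_SolSet (R : realType) (M N : nat) (U : set 'rV[R]_N)
    (F : 'rV[R]_N -> 'rV[R]_M) (p : 'rV[R]_N) : Prop :=
  forall x, SolSet U F p x -> robust F x.

Definition fragile_SolSet (R : realType) (M N : nat) (U : set 'rV[R]_N)
    (F : 'rV[R]_N -> 'rV[R]_M) (p : 'rV[R]_N) : Prop :=
  ~ robust_SolSet U F p.

(* Main.v *)
Require Import Defs.
From HB Require Import structures.
From mathcomp Require Import all_boot all_order all_algebra.
From mathcomp Require Import mathcomp_extra boolp classical_sets functions reals.
From mathcomp Require Import topology normedtype derive.
Import Order.TTheory GRing.Theory Num.Theory.
Import numFieldNormedType.Exports.
Local Open Scope classical_set_scope.
Local Open Scope ring_scope.

(** At a point where [F] is differentiable, the [(i, j)] entry of the Jacobian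
    is the partial derivative of the [i]-th component of [F] in the [j]-th
    variable, so the vanishing conditions in the structure are zero conditions
    on the entries of the Jacobian ([DF_respects]). The Jacobian at every point
    of [U] is therefore itself one of the matrices over which the maximal rank
    [r] is taken, and its rank is at most [r < M]: no point of [U] is robust.
    Since [p] belongs to its own solution set, that set is fragile too. *)

Lemma DFE (R : realType) (M N : nat) (F : 'rV[R]_N -> 'rV[R]_M)
    (x : 'rV[R]_N) (i : 'I_M) (j : 'I_N) :
  differentiable F x -> DF F x i j = partial j (fun y => F y 0 i : R) x.
Proof.
move=> dF; have derF : derivable F x (delta_mx 0 j) by exact: diff_derivable.
rewrite /DF /jacobian !mxE /partial.
transitivity (('D_(delta_mx 0 j) F x) 0 i).
  by rewrite deriveE.
by rewrite derive_mx // mxE.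
Qed.

Lemma DF_respects (R : realType) (M N : nat) (U : set 'rV[R]_N)
    (S : structure M N) (F : 'rV[R]_N -> 'rV[R]_M) (x : 'rV[R]_N) :
  respects S U F -> U x -> differentiable F x -> mx_respects S (DF F x).
Proof. by move=> SF Ux dF i j Sij; rewrite DFE//; exact: SF. Qed.

Theorem proposition2 (R : realType) (M N : nat) (U : set 'rV[R]_N)
    (S : structure M N) (FF : set ('rV[R]_N -> 'rV[R]_M))
    (U_open : open U)
    (FF_space : function_space U FF)
    (FF_smooth : forall F, FF F -> C_infty U F)
    (FF_respects : forall F, FF F -> respects S U F)
    (FF_linear : forall A : 'M[R]_(M, N), mx_respects S A -> FF (linear_map A))
    (r_lt_M : (max_rank R S < M)%N) :
  (forall F p, FF F -> U p -> fragile F p) /\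
  (forall F p, FF F -> U p -> fragile_SolSet U F p).
Proof.
have fragileU F p : FF F -> U p -> fragile F p.
  move=> FFF Up rankM.
  have [dF _] := FF_smooth F FFF 1%N.
  have SDF := DF_respects _ _ _ _ S _ _ (FF_respects F FFF) Up (dF p Up).
  by move: r_lt_M; rewrite ltnNge -{1}rankM max_rank_ge.
split=> // F p FFF Up robustSol.
by apply: (fragileU F p FFF Up); apply: robustSol.
Qed.
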